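(* Let $(\Omega,\Sigma,\mu)$ be a localizable measure space and let $X$ be a real Banach space which is a predual of $L_1(\mu)$, that is, $X^*=L_1(\mu)$ (isometrically). If every convex combination of slices of $B_X$ has non-empty relative weak interior in $B_X$ (i.e. $X$ has property (W2)), then $\mu$ is purely atomic.
   Context: All Banach spaces are real. $B_X$ and $S_X$ denote the closed unit ball and the unit sphere of $X$, and $X^*$ is the topological dual. A slice of $B_X$ is a set $S(B_X,f,\alpha):=\{x\in B_X: f(x)>1-\alpha\}$ with $f\in S_{X^*}$ and $\alpha>0$. A convex combination of slices of $B_X$ is a set $\sum_{i=1}^n\lambda_i S_i$ (Minkowski sum), where $\lambda_1,\dots,\lambda_n\in[0,1]$, $\sum_{i=1}^n\lambda_i=1$, and each $S_i$ is a slice of $B_X$. The relative weak interior of $C\subseteq B_X$ is its interior as a subset of $B_X$ endowed with the weak topology of $X$. A measure space is localizable if it is semifinite and every family of measurable sets has an essential supremum in $\Sigma$. $\mu$ is purely atomic if every measurable set of positive measure contains an atom of $\mu$. *)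

(* Defs.v *)
From HB Require Import structures.
From mathcomp Require Import all_boot all_order all_algebra.
From mathcomp Require Import all_classical all_reals all_analysis.

Set Implicit Arguments.
Unset Strict Implicit.
Unset Printing Implicit Defensive.

Import Order.TTheory GRing.Theory Num.Theory.
Import numFieldNormedType.Exports.

Local Open Scope classical_set_scope.
Local Open Scope ring_scope.

Section MeasureSpaces.
Context d (T : measurableType d) (R : realType).
Variable mu : {measure set T -> \bar R}.

Definition semifinite := forall E : set T, measurable E -> mu E = +oo%E ->
  exists F : set T,
    [/\ measurable F, F `<=` E, (0 < mu F)%E & (mu F < +oo)%E].

Definition essential_supremum (G : set (set T)) (H : set T) :=
  [/\ measurable H,
      forall E, G E -> mu (E `\` H) = 0%E
    & forall K, measurable K -> (forall E, G E -> mu (E `\` K) = 0%E) ->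
        mu (H `\` K) = 0%E].

Definition localizable := semifinite /\
  forall G : set (set T), G `<=` measurable -> exists H, essential_supremum G H.

Definition atom (A : set T) :=
  [/\ measurable A, (0 < mu A)%E
    & forall B, measurable B -> B `<=` A ->
        mu B = 0%E \/ mu (A `\` B) = 0%E].

Definition purely_atomic := forall E : set T, measurable E -> (0 < mu E)%E ->
  exists2 A, atom A & A `<=` E.

End MeasureSpaces.

Section BanachSpaces.
Context (R : realType).
Variable X : completeNormedModType R.

Definition unit_ball : set X := [set x | `|x| <= 1].

(* The topological dual, as a set of functions; its vector space structure is
   the pointwise one. *)
Definition dual : set (X -> R) :=
  [set f | linear (f : X -> R^o) /\ continuous f].

(* The supremum is taken in R, so it is meaningful for bounded functions on the
   unit ball, in particular for all elements of the dual. *)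
Definition dual_norm (f : X -> R) : R := sup [set `|f x| | x in unit_ball].

(* X endowed with its weak topology: the coarsest topology for which every
   element of the dual is continuous. *)
Definition weak : Type := sup_topology
  (fun f : set_type dual => Topological.on (initial_topology (\val f : X -> R))).

HB.instance Definition _ := Topological.on weak.

(* Since [subspace B] keeps the carrier of [weak] and makes the points outside B
   isolated, this is the relative interior only for C included in the ball. *)
Definition relative_weak_interior (C : set X) : set X :=
  interior (C : set (subspace (unit_ball : set weak))).

Definition slice (f : X -> R) (alpha : R) : set X :=
  [set x | unit_ball x /\ 1 - alpha < f x].

Definition is_slice (S : set X) := exists f alpha,
  [/\ dual f, dual_norm f = 1, 0 < alpha & S = slice f alpha].

Definition convex_combination_of_slices (C : set X) :=
  exists n (lam : 'I_n -> R) (S : 'I_n -> set X),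
    [/\ forall i, 0 <= lam i <= 1, \sum_(i < n) lam i = 1,
        forall i, is_slice (S i)
      & C = [set \sum_(i < n) lam i *: x i | x in [set x | forall i, S i (x i)]]].

Definition W2 := forall C, convex_combination_of_slices C ->
  relative_weak_interior C !=set0.

End BanachSpaces.

(* J is a surjective linear isometry from L_1(mu) to the dual of X. An element
   of [LspaceType1 mu] is a class of functions modulo equality almost
   everywhere, which coerces to one of its representatives. The library puts no
   vector space structure on this type, so linearity is expressed through
   representatives: h is the class of a f + g. *)
Definition isometric_isomorphism_L1_dual d (T : measurableType d)
    (R : realType) (mu : {measure set T -> \bar R})
    (X : completeNormedModType R) (J : LspaceType1 mu -> X -> R) :=
  [/\ forall (a : R) (f g h : LspaceType1 mu),
        ae_eq mu setT (h : T -> R) (fun t => a * (f t : R) + (g t : R)) ->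
        J h = (fun x => a * J f x + J g x),
      forall f : LspaceType1 mu,
        (dual_norm (J f))%:E = 'N[mu]_1[EFin \o (f : T -> R)]%E
    & range J = @dual R X].

Definition is_predual_of_L1 d (T : measurableType d) (R : realType)
    (mu : {measure set T -> \bar R}) (X : completeNormedModType R) :=
  exists J : LspaceType1 mu -> X -> R, isometric_isomorphism_L1_dual J.

(* Main.v *)
Require Import Defs.
From HB Require Import structures.
From mathcomp Require Import all_boot all_order all_algebra.
From mathcomp Require Import all_classical all_reals all_analysis.
From mathcomp Require Import measurable_realfun ring lra.

Set Implicit Arguments.
Unset Strict Implicit.
Unset Printing Implicit Defensive.

Import Order.TTheory GRing.Theory Num.Theory.
Import numFieldNormedType.Exports.

Local Open Scope classical_set_scope.
Local Open Scope ring_scope.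

(** If mu is semifinite but not purely atomic, some E with 0 < mu(E) < oo
    contains no atom. Let f be the indicator of E divided by mu(E), regarded as
    a norm-one functional on X, and let C be the half-sum of the slices
    {f > 1/2} and {- f > 1/2} of the ball.

    A point of the ball where f is almost 1 must be almost 1 on most of E, in
    the sense of X** = L_1(mu)^*, and one where f is almost -1 must be almost
    -1 there; their midpoint is small on E. Quantitatively
    ([slice_midpoint]), if u is f with its sign changed on some measurable part
    of E, then u < 1/2 on all of C.

    On the other hand E has no atom, so every weak neighbourhood in the ball of
    a point x0 contains points that look like a function of modulus 1 on E. Let
    g_1, ..., g_n in L_1(mu) define the neighbourhood. By Sierpinski's
    intermediate value theorem ([sierpinski]) E can be cut into A and E \ A so
    that the sign function 1_A - 1_(E \ A) integrates any finite family of
    indicators exactly as x0 does ([split_measure]), hence, by density of simple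
    functions, integrates every g_i over E almost as x0 does
    ([sign_matching]). The functional on L_1(mu) that is this sign function on E
    and x0 off E has norm at most 1. Goldstine's theorem, used here in Helly's
    finite form ([helly], [L1_goldstine]), replaces it by a point x of the ball
    with almost the same values at the g_i and at u; then x is in the
    neighbourhood and u(x) is almost 1 ([ball_sign_approx]). Therefore C
    contains no nonempty relatively weakly open subset of the ball, against
    (W2). *)

(** * Dual functionals and a finite form of Goldstine's theorem *)

Section Dual.
Context (R : realType) (X : completeNormedModType R).
Implicit Types (f : X -> R) (x y : X).

Lemma dualP f : dual f -> forall a x y, f (a *: x + y) = a * f x + f y.
Proof. by move=> [lf _] a x y; exact: lf. Qed.

Lemma dual0 f : dual f -> f 0 = 0.
Proof.
move=> df; have := dualP df 1 0 0.
by rewrite scale1r add0r mul1r => h; rewrite -[LHS](addrK (f 0)) -h subrr.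
Qed.

Lemma dualZ f : dual f -> forall a x, f (a *: x) = a * f x.
Proof. by move=> df a x; rewrite -[a *: x]addr0 dualP// dual0// addr0. Qed.

Lemma dualN f : dual f -> forall x, f (- x) = - f x.
Proof. by move=> df x; rewrite -scaleN1r dualZ// mulN1r. Qed.

Lemma dualD f : dual f -> forall x y, f (x + y) = f x + f y.
Proof. by move=> df x y; rewrite -[x in LHS]scale1r dualP// mul1r. Qed.

Lemma unit_ballN x : unit_ball x -> unit_ball (- x).
Proof. by rewrite /unit_ball/= normrN. Qed.

Lemma unit_ball_convex (t : R) x y : 0 <= t <= 1 ->
  unit_ball x -> unit_ball y -> unit_ball (x + t *: (y - x)).
Proof.
rewrite /unit_ball/= => /andP[t0 t1] x1 y1.
have -> : x + t *: (y - x) = (1 - t) *: x + t *: y.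
  by rewrite scalerBr scalerBl scale1r addrA addrAC.
rewrite (le_trans (ler_normD _ _))// !normrZ (ger0_norm t0) ger0_norm ?subr_ge0//.
by nra.
Qed.

Lemma dual_bounded f : dual f -> has_ubound [set `|f x| | x in @unit_ball _ X].
Proof.
move=> df; have [_ cf] := df.
have /cvgrPdist_lt /(_ 1 ltr01) := cf 0.
rewrite dual0// => /nbhs_ballP[e/= e0 he].
exists (2 / e) => _ [x x1 <-].
have : `|0 - f ((e / 2) *: x)| < 1.
  apply: he; rewrite -ball_normE /ball_/= sub0r normrN normrZ gtr0_norm ?divr_gt0//.
  rewrite (le_lt_trans (ler_piMr _ x1)) ?divr_ge0 ?(ltW e0)//.
  by rewrite ltr_pdivrMr// mulr_natr mulr2n ltrDl.
rewrite sub0r normrN dualZ// normrM gtr0_norm ?divr_gt0// => h.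
by rewrite ler_pdivlMr// mulrC; move: h; nra.
Qed.

Lemma le_dual_norm f x : dual f -> unit_ball x -> `|f x| <= dual_norm f.
Proof.
move=> df x1; apply: ub_le_sup; first exact: dual_bounded.
by exists x.
Qed.

Lemma dual_norm_le f (M : R) : dual f ->
  (forall x, unit_ball x -> f x <= M) -> dual_norm f <= M.
Proof.
move=> df fM; apply: ge_sup.
  by exists `|f 0|, 0 => //; rewrite /unit_ball/= normr0.
move=> _ [x x1 <-]; rewrite ler_norml fM// andbT lerNl -dualN//.
exact/fM/unit_ballN.
Qed.

Lemma dual_comb (I : finType) (a : I -> R) (phi : I -> X -> R) :
  (forall i, dual (phi i)) -> dual (fun x => \sum_i a i * phi i x).
Proof.
move=> dphi; split => [b x y|x].
  rewrite scaler_sumr -big_split/=; apply: eq_bigr => i _.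
  by rewrite dualP// /GRing.scale/=; ring.
have -> : (fun x => \sum_i a i * phi i x) = \sum_i (fun x => a i * phi i x).
  by rewrite fct_sumE.
elim/big_rec: _ x => [|i g _ cg] x; first exact: cvg_cst.
by apply: cvgD (cg x); apply: cvgMr; have [_] := dphi i; exact.
Qed.

(** Helly's condition in finite dimension: c lies in the closure of the image K
    of the unit ball under x |-> (phi_i x)_i as soon as no linear functional a
    separates it from K. The closest point of K to c need not exist, so the
    proof takes x whose squared distance Q x to c is within t * d of the infimum
    d of Q. Moving from x towards another point y by a proportion t cannot bring
    Q below d, which forces the functional a = c - phi(x) to be almost maximal
    at x on K; this contradicts the hypothesis for that a if d > 0. *)
Lemma helly (I : finType) (phi : I -> X -> R) (c : I -> R) :
  (forall i, dual (phi i)) ->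
  (forall a : I -> R,
     \sum_i a i * c i <= dual_norm (fun x => \sum_i a i * phi i x)) ->
  forall e, 0 < e ->
  exists2 x, unit_ball x & forall i, `|phi i x - c i| < e.
Proof.
move=> dphi hc e e0; apply: contrapT => noapprox.
pose Q x := \sum_i (phi i x - c i) ^+ 2.
have Qe x : unit_ball x -> e ^+ 2 <= Q x.
  move=> x1; have [i hi] : exists i, ~ (`|phi i x - c i| < e).
    by apply: contrapT => /forallNP h; apply: noapprox; exists x => // i; apply: contrapT (h i).
  rewrite /Q (bigD1 i)//= ler_wpDr ?sumr_ge0// => [j _|]; first exact: sqr_ge0.
  rewrite -(real_normK (num_real (_ - _))) lerXn2r ?nnegrE ?(ltW e0)//.
  by rewrite leNgt; apply/negP.
pose S := [set Q x | x in @unit_ball _ X].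
have S0 : S !=set0 by exists (Q 0), 0 => //; rewrite /unit_ball/= normr0.
have lbS : lbound S (e ^+ 2) by move=> _ [x x1 <-]; exact: Qe.
have iS : has_inf S by split=> //; exists (e ^+ 2).
set d := inf S.
have d0 : 0 < d by apply: (lt_le_trans (exprn_gt0 2 e0)); exact: lb_le_inf.
pose D := \sum_i (2 * dual_norm (phi i)) ^+ 2.
have D0 : 0 <= D by apply: sumr_ge0 => i _; exact: sqr_ge0.
have QD x y : unit_ball x -> unit_ball y ->
    \sum_i (phi i y - phi i x) ^+ 2 <= D.
  move=> x1 y1; apply: ler_sum => i _.
  rewrite -(real_normK (num_real (_ - _))) lerXn2r ?nnegrE//.
    by rewrite mulr_ge0// (le_trans _ (le_dual_norm (dphi i) x1)).
  rewrite (le_trans (ler_normB _ _))// mulr2n mulrDl mul1r lerD//; exact: le_dual_norm.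
(* This t makes the second-order term t ^+ 2 * D at most t * (d / 2), while
   t <= 1 keeps the segment inside the ball. *)
pose t := d / (2 * D + d).
have t0 : 0 < t by rewrite divr_gt0// ltr_wpDl// mulr_ge0.
have t1 : t <= 1 by rewrite ler_pdivrMr ?mul1r ?lerDr ?mulr_ge0// ltr_wpDl// mulr_ge0.
have tD : t * D <= d / 2.
  rewrite /t mulrAC ler_pdivrMr ?ltr_wpDl ?mulr_ge0//.
  by nra.
have [_ [x x1 <-] Qx] := inf_adherent (mulr_gt0 t0 d0) iS.
rewrite -/d in Qx.
pose a i := c i - phi i x.
have QE : Q x = \sum_i a i * c i - \sum_i a i * phi i x.
  by rewrite /Q -sumrB; apply: eq_bigr => i _; rewrite /a; ring.
have dQx : d <= Q x by apply: ge_inf; [exact: iS.2 | exists x].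
(* Since <a, c> = <a, phi x> + Q x with Q x >= d, any bound below d suffices. *)
have step y : unit_ball y ->
    \sum_i a i * phi i y <= \sum_i a i * phi i x + 3 / 4 * d.
  move=> y1.
  have : d <= Q (x + t *: (y - x)).
    apply: ge_inf; first exact: iS.2.
    exists (x + t *: (y - x)) => //.
    by apply: unit_ball_convex => //; rewrite (ltW t0).
  have -> : Q (x + t *: (y - x)) = Q x
      - 2 * t * (\sum_i a i * phi i y - \sum_i a i * phi i x)
      + t ^+ 2 * \sum_i (phi i y - phi i x) ^+ 2.
    rewrite /Q -sumrB !mulr_sumr -sumrB -big_split/=; apply: eq_bigr => i _.
    by rewrite dualD// dualZ// dualD// dualN// /a; ring.
  have := QD _ _ x1 y1.
  set A := \sum_i _; set B := \sum_i _ * phi i y; set C := \sum_i _ * phi i x.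
  move=> AD dle.
  have h1 : t ^+ 2 * A <= t * (d / 2).
    rewrite expr2 -mulrA ler_wpM2l ?(ltW t0)//.
    by rewrite (le_trans _ tD)// ler_wpM2l// ltW.
  have h2 : t * (2 * (B - C)) <= t * (3 / 2 * d) by lra.
  by move: h2; rewrite ler_pM2l//; lra.
have := le_trans (hc a) (dual_norm_le (dual_comb _ dphi) step).
by lra.
Qed.

End Dual.

(** * Weak neighbourhoods and slices *)

Section WeakTopology.
Context (R : realType) (X : completeNormedModType R).

(** The sets on the right are the usual basic neighbourhoods. They form a filter
    converging to x0 in each of the initial topologies, hence in their
    supremum. *)
Lemma weak_nbhs (x0 : X) (U : set X) : nbhs (x0 : weak X) U ->
  exists s : seq (X -> R), exists e : R,
    [/\ 0 < e, forall phi, phi \in s -> dual phi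
      & forall x, (forall phi, phi \in s -> `|phi x - phi x0| < e) -> U x].
Proof.
pose F : set_system X := [set U | exists s : seq (X -> R), exists e : R,
    [/\ 0 < e, forall phi, phi \in s -> dual phi
      & forall x, (forall phi, phi \in s -> `|phi x - phi x0| < e) -> U x]].
have FF : Filter F.
  split.
  - by exists [::], 1; split.
  - move=> A B [s [e [e0 ds hs]]] [s' [e' [e'0 ds' hs']]].
    exists (s ++ s'), (Num.min e e'); split.
    + by rewrite lt_min e0.
    + by move=> phi; rewrite mem_cat => /orP[/ds|/ds'].
    + move=> x hx; split; [apply: hs|apply: hs'] => phi phis.
        by have := hx phi; rewrite mem_cat phis lt_min => /(_ isT)/andP[].
      by have := hx phi; rewrite mem_cat phis orbT lt_min => /(_ isT)/andP[].
  - move=> A B AB [s [e [e0 ds hs]]]; exists s, e; split => // x hx.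
    exact/AB/hs.
suff : F --> (x0 : weak X) by move=> /[apply].
apply/cvg_sup => phi A [_ [[B oB <-] Bx0 BA]].
have [e/= e0 he] : nbhs_ball (sval phi x0) B by apply/nbhs_ballP; apply: open_nbhs_nbhs.
exists [:: sval phi], e; split => //.
  by move=> f; rewrite inE => /eqP ->; exact: set_valP.
move=> x hx; apply: BA; apply: he; rewrite -ball_normE/= distrC.
by apply: hx; rewrite inE.
Qed.

Lemma relative_weak_interiorP (C : set X) (x0 : X) : C `<=` @unit_ball _ X ->
  relative_weak_interior C x0 ->
  unit_ball x0 /\ exists s : seq (X -> R), exists e : R,
    [/\ 0 < e, forall phi, phi \in s -> dual phi
      & forall x, unit_ball x ->
          (forall phi, phi \in s -> `|phi x - phi x0| < e) -> C x].
Proof.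
move=> CB x0C; have x0B : unit_ball x0 by exact/CB/(interior_subset x0C).
split=> //.
have : within (@unit_ball R X : set (weak X)) (nbhs (x0 : weak X)) C.
  by rewrite nbhs_subspace_in.
move=> /weak_nbhs[s [e [e0 ds hs]]]; exists s, e; split => // x x1 hx.
exact: hs hx x1.
Qed.

Lemma is_sliceN f alpha : dual f -> dual_norm f = 1 -> 0 < alpha ->
  is_slice (slice (fun x : X => - f x) alpha).
Proof.
move=> df f1 a0; exists (fun x => - f x), alpha; split => //; last first.
  rewrite -f1 /dual_norm; congr (sup _).
  by apply/seteqP; split=> _ [x x1 <-]; exists x; rewrite ?normrN.
split=> [a x y|x]; first by rewrite dualP// /GRing.scale/=; ring.
by apply: cvgN; have [_] := df; exact.
Qed.

(** The instance of (W2) that is used: the half-sum of the slice given by f and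
    the opposite one. *)
Lemma W2_symmetric_slices (f : X -> R) (alpha : R) :
  W2 X -> dual f -> dual_norm f = 1 -> 0 < alpha ->
  exists x0 : X, unit_ball x0 /\ exists s : seq (X -> R), exists e : R,
    [/\ 0 < e, forall phi, phi \in s -> dual phi
      & forall x, unit_ball x ->
          (forall phi, phi \in s -> `|phi x - phi x0| < e) ->
          exists y z, [/\ slice f alpha y, slice (fun x => - f x) alpha z
                        & x = 2^-1 *: (y + z)]].
Proof.
move=> w2 df f1 a0.
pose S (i : 'I_2) := if i == ord0 then slice f alpha else slice (fun x => - f x) alpha.
pose C := [set \sum_(i < 2) (2^-1 : R) *: x i | x in [set x | forall i, S i (x i)]].
have CP x : C x -> exists y z, [/\ slice f alpha y, slice (fun x => - f x) alpha z
                        & x = 2^-1 *: (y + z)].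
  move=> [u hu <-]; exists (u ord0), (u ord_max).
  split; [exact: (hu ord0)|exact: (hu ord_max)|].
  by rewrite !big_ord_recl big_ord0 addr0 scalerDr; congr (_ *: u _ + _ *: u _); exact: val_inj.
have CB : C `<=` @unit_ball _ X.
  move=> x /CP[y [z [[y1 _] [z1 _] ->]]].
  have -> : 2^-1 *: (y + z) = y + 2^-1 *: (z - y).
    rewrite scalerDr scalerBr addrCA addrC; congr (_ + _).
    by rewrite -[X in X - _]scale1r -scalerBl; congr (_ *: _); lra.
  by apply: unit_ball_convex => //; apply/andP; split; lra.
have [|x0 /(relative_weak_interiorP CB)[x01 [s [e [e0 ds hs]]]]] := w2 C.
  exists 2%N, (fun=> 2^-1), S; split => //.
  - by move=> i; apply/andP; split; lra.
  - by rewrite !big_ord_recl big_ord0; lra.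
  - move=> i; rewrite /S; case: ifP => _; last exact: is_sliceN.
    by exists f, alpha; split.
exists x0; split=> //; exists s, e; split=> // x x1 hx.
by apply: CP; exact: hs.
Qed.

End WeakTopology.

(** * Splitting atomless sets *)

Section Sierpinski.
Context d (T : measurableType d) (R : realType).
Variable mu : {measure set T -> \bar R}.
Implicit Types (A B E F : set T).

Local Notation m A := (fine (mu A)).

Definition finite_atomless E :=
  [/\ measurable E, (mu E < +oo)%E & forall A, A `<=` E -> ~ atom mu A].

Lemma finite_atomlessS E F : finite_atomless E -> measurable F -> F `<=` E ->
  finite_atomless F.
Proof.
move=> [mE Eoo atE] mF FE; split=> //.
  by apply: le_lt_trans Eoo; apply: le_measure => //; rewrite inE.
by move=> A AF; apply: atE; exact: subset_trans FE.
Qed.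

Lemma finite_atomless_fin_num E A : finite_atomless E -> measurable A ->
  A `<=` E -> mu A \is a fin_num.
Proof.
by move=> hE mA AE; have [_ Aoo _] := finite_atomlessS hE mA AE; rewrite ge0_fin_numE.
Qed.

Lemma fine_measureU E A B : finite_atomless E -> measurable A -> measurable B ->
  A `<=` E -> B `<=` E -> A `&` B = set0 -> m (A `|` B) = m A + m B.
Proof.
move=> hE mA mB AE BE AB0; rewrite measureU// fineD//; exact: finite_atomless_fin_num hE _ _.
Qed.

Lemma fine_measureD E A : finite_atomless E -> measurable A -> A `<=` E ->
  m E = m A + m (E `\` A).
Proof.
move=> hE mA AE; have [mE _ _] := hE.
by rewrite -(fine_measureU hE) ?setDUK ?setDIK//; exact: measurableD.
Qed.

Lemma fine_measure_le E A B : finite_atomless E -> measurable A -> measurable B ->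
  A `<=` B -> B `<=` E -> m A <= m B.
Proof.
move=> hE mA mB AB BE; apply: fine_le.
- by apply: finite_atomless_fin_num hE mA _; exact: subset_trans BE.
- exact: finite_atomless_fin_num hE mB BE.
- by apply: le_measure => //; rewrite inE.
Qed.

Lemma fine_measure_gt0 E A : finite_atomless E -> measurable A -> A `<=` E ->
  mu A <> 0%E -> 0 < m A.
Proof.
move=> hE mA AE A0; rewrite fine_gt0// lt0e measure_ge0 andbT.
have := finite_atomless_fin_num hE mA AE; rewrite ge0_fin_numE// => ->.
by rewrite andbT; exact/eqP.
Qed.

(** A set that is not an atom splits into two parts of positive measure, one of
    which has at most half of the measure. *)
Lemma atomless_half E : finite_atomless E -> 0 < m E ->
  exists B, [/\ measurable B, B `<=` E, 0 < m B & m B <= m E / 2].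
Proof.
move=> hE mE0; have [mE Eoo atE] := hE.
have [B [mB BE B0 EB0]] : exists B, [/\ measurable B, B `<=` E,
    mu B <> 0%E & mu (E `\` B) <> 0%E].
  apply: contrapT => noB; apply: (atE E) => //; split => //.
    by rewrite lt0e measure_ge0 andbT; apply/eqP => h; rewrite h ltxx in mE0.
  move=> B mB BE; apply: contrapT => /not_orP[B0 EB0].
  by apply: noB; exists B.
have mEB : measurable (E `\` B) by exact: measurableD.
have EBE : E `\` B `<=` E by move=> x [].
have mEE := fine_measureD hE mB BE.
have [leB|ltB] := leP (m B) (m E / 2).
  by exists B; split => //; exact: fine_measure_gt0 hE _ _ _.
exists (E `\` B); split => //; first exact: fine_measure_gt0 hE _ _ _.
by lra.
Qed.

Lemma atomless_small E (e : R) : finite_atomless E -> 0 < m E -> 0 < e ->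
  exists B, [/\ measurable B, B `<=` E, 0 < m B & m B <= e].
Proof.
move=> hE mE0 e0.
have small n : exists B, [/\ measurable B, B `<=` E, 0 < m B & m B <= m E / 2 ^+ n].
  elim: n => [|n [B [mB BE B0 Bn]]].
    by exists E; have [? _ _] := hE; split => //; rewrite expr0 divr1.
  have [C [mC CB C0 CBh]] := atomless_half (finite_atomlessS hE mB BE) B0.
  exists C; split => //; first exact: subset_trans BE.
  rewrite (le_trans CBh)// exprSr invfM mulrA ler_wpM2r// invr_ge0//.
have [n hn] : exists n : nat, m E / e <= 2 ^+ n.
  exists (Num.bound (m E / e)).
  rewrite (le_trans (ltW (archi_boundP _)))// ?divr_ge0 ?(ltW mE0, ltW e0)// ltW//.
  by rewrite -natrX ltr_nat ltn_expl.
have [B [mB BE B0 Bn]] := small n; exists B; split => //.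
by rewrite (le_trans Bn)// ler_pdivrMr ?exprn_gt0// mulrC -ler_pdivrMr.
Qed.

(** Sierpinski's theorem, by a greedy construction: starting from the empty set,
    keep adding a set whose measure is at least half of the largest amount that
    does not overshoot s. If the union stopped short of s, a small leftover set
    C of positive measure ([atomless_small]) could have been added at every
    stage, so every stage would have contributed at least m C / 2, and the
    measures would be unbounded. *)
Lemma sierpinski E (s : R) : finite_atomless E -> 0 <= s <= m E ->
  exists A, [/\ measurable A, A `<=` E & m A = s].
Proof.
move=> hE /andP[s0 sE]; have [mE Eoo atE] := hE.
pose good A := [/\ measurable A, A `<=` E & m A <= s].
pose ext A B := [/\ measurable B, B `<=` E `\` A & m A + m B <= s].
have greedy A : exists B, good A -> ext A B /\ forall C, ext A C -> m C <= 2 * m B.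
  have [gA|ngA] := pselect (good A); last by exists set0.
  have [mA AE As] := gA.
  pose S := [set m B | B in ext A].
  have ext0 : ext A set0 by split => //; rewrite measure0/= addr0.
  have hS : has_sup S.
    split; first by exists (m set0), set0.
    by exists (s - m A) => _ [B [_ _ hB] <-]; rewrite lerBrDl.
  have [S0|S0] := leP (sup S) 0.
    exists set0 => _; split=> // C hC; rewrite measure0/= mulr0 (le_trans _ S0)//.
    by apply: ub_le_sup; [exact: hS.2|exists C].
  have [|_ [B hB <-] SB] := @sup_adherent _ S (sup S / 2) _ hS.
    by rewrite divr_gt0.
  exists B => _; split=> // C hC.
  have : m C <= sup S by apply: ub_le_sup; [exact: hS.2|exists C].
  by lra.
have [P hP] := choice greedy.
pose A_ n := iter n (fun A => A `|` P A) set0.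
have goodA n : good (A_ n).
  elim: n => [|n gA]; first by split => //=; rewrite measure0.
  have [[mP PE Ps] _] := hP _ gA; have [mA AE As] := gA.
  have PE' : P (A_ n) `<=` E by move=> x /PE[].
  split; first exact: measurableU.
    by move=> x [/AE|/PE'].
  rewrite /= (fine_measureU hE)//.
  by apply/seteqP; split => // x [Ax /PE[]].
have mA_ n : measurable (A_ n) by have [] := goodA n.
have ndA : {homo A_ : n k / (n <= k)%N >-> (n <= k)%O}.
  by apply/nondecreasing_seqP => n; apply/subsetPset => x Ax; left.
pose A := \bigcup_n A_ n.
have mA : measurable A by exact: bigcupT_measurable.
have AE : A `<=` E by move=> x [n _]; have [_ AE _] := goodA n; exact: AE.
have fA n : mu (A_ n) \is a fin_num.
  by have [? ? _] := goodA n; exact: finite_atomless_fin_num hE _ _.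
have As : m A <= s.
  rewrite -lee_fin fineK; last exact: finite_atomless_fin_num hE mA AE.
  have cvA : (mu \o A_) n @[n --> \oo] --> mu A.
    exact: nondecreasing_cvg_mu.
  have <- : lim ((mu \o A_) n @[n --> \oo]) = mu A by exact: cvg_lim.
  apply: lime_le; first by apply/cvg_ex; exists (mu A).
  by near=> n; have [_ _ hn] := goodA n; rewrite /= -(fineK (fA n)) lee_fin.
exists A; split => //; apply/eqP; rewrite eq_le As/= leNgt; apply/negP => Alt.
have EAE : E `\` A `<=` E by move=> x [].
have mEA : measurable (E `\` A) by exact: measurableD.
have mEE := fine_measureD hE mA AE.
have [|||C [mC CEA C0 Cs]] := @atomless_small (E `\` A) (s - m A).
- exact: finite_atomlessS hE _ _.
- by lra.
- by lra.
have extC n : ext (A_ n) C.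
  have AnA : A_ n `<=` A by move=> x Ax; exists n.
  split => //.
    by move=> x /CEA[Ex nAx]; split => // /AnA.
  have : m (A_ n) <= m A by exact: fine_measure_le hE _ _ _ _.
  by lra.
have growth n : n%:R * (m C / 2) <= m (A_ n).
  elim: n => [|n IH]; first by rewrite mul0r.
  have gA := goodA n; have [mAn AnE _] := gA.
  have [[mP PE _] hC] := hP _ gA.
  have PE' : P (A_ n) `<=` E by move=> x /PE[].
  rewrite /= (fine_measureU hE)//; last by apply/seteqP; split => // x [Ax /PE[]].
  rewrite -natr1 mulrDl mul1r lerD// ler_pdivrMr// mulrC.
  exact/hC/extC.
have C2 : 0 < m C / 2 by rewrite divr_gt0.
have := archi_boundP (divr_ge0 s0 (ltW C2)).
set n := Num.bound _; rewrite ltr_pdivrMr// ltNge => /negP; apply.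
by rewrite (le_trans (growth n))//; have [] := goodA n.
Unshelve. all: by end_near. Qed.

(** A discrete form of Lyapunov's convexity theorem: an additive set function
    nu dominated by mu on E agrees on a finite family of sets with the signed
    measure whose density is a sign function. By induction on the family, a new
    member G cuts E into two pieces treated separately; the clause F = setT,
    which prescribes the value on the whole of each piece, is what makes the two
    solutions also correct for G itself. The base case is [sierpinski]. *)
Lemma split_measure (nu : set T -> R) (Fs : seq (set T)) E :
  finite_atomless E ->
  (forall F, F \in Fs -> measurable F) ->
  (forall A, measurable A -> A `<=` E -> `|nu A| <= m A) ->
  (forall A B, measurable A -> measurable B -> A `<=` E -> B `<=` E ->
     A `&` B = set0 -> nu (A `|` B) = nu A + nu B) ->
  exists A, [/\ measurable A, A `<=` E
    & forall F, F \in setT :: Fs ->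
        m (A `&` F) - m ((E `\` A) `&` F) = nu (E `&` F)].
Proof.
elim: Fs E => [|G Fs IH] E hE mFs nule nuD; have [mE Eoo atE] := hE.
  have := nule E mE (@subset_refl _ E); rewrite ler_norml => /andP[nE En].
  have [|A [mA AE As]] := @sierpinski E ((m E + nu E) / 2) hE.
    by apply/andP; split; lra.
  exists A; split => // F; rewrite inE => /eqP ->; rewrite !setIT.
  by have := fine_measureD hE mA AE; move: As; clear; lra.
have mG : measurable G by apply: mFs; rewrite inE eqxx.
have mFs' F : F \in Fs -> measurable F by move=> FF; apply: mFs; rewrite inE FF orbT.
have restr D : measurable D -> D `<=` E -> exists A, [/\ measurable A, A `<=` D
    & forall F, F \in setT :: Fs -> m (A `&` F) - m ((D `\` A) `&` F) = nu (D `&` F)].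
  move=> mD DE; apply: IH => //.
  - exact: finite_atomlessS hE _ _.
  - by move=> A mA AD; apply: nule => //; exact: subset_trans DE.
  - by move=> A B mA mB AD BD; apply: nuD => //; exact: subset_trans DE.
have mEG : measurable (E `&` G) by exact: measurableI.
have mEDG : measurable (E `\` G) by exact: measurableD.
have [|A [mA AEG hA]] := restr _ mEG; first by move=> x [].
have [|B [mB BEG hB]] := restr _ mEDG; first by move=> x [].
exists (A `|` B); split => [||F].
- exact: measurableU.
- by move=> x [/AEG[]|/BEG[]].
- move=> FF.
  have mF : measurable F.
    by case/predU1P: FF => [->|/predU1P[->|/mFs']].
  have [eqA eqB] : m (A `&` F) - m (((E `&` G) `\` A) `&` F) = nu (E `&` G `&` F) /\
      m (B `&` F) - m (((E `\` G) `\` B) `&` F) = nu ((E `\` G) `&` F).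
    case/predU1P: FF => [->|/predU1P[->|FF]].
    + by split; [apply: hA|apply: hB]; rewrite inE eqxx.
    + have GB : (E `\` G) `&` G = set0 by apply/seteqP; split => // x [[]].
      have -> : B `&` G = set0 by apply/seteqP; split => // x [/BEG[]].
      have -> : ((E `\` G) `\` B) `&` G = set0.
        by apply/seteqP; split => // x [[[]]].
      have := hA setT; rewrite inE eqxx => /(_ isT); rewrite !setIT.
      have AG : A `&` G = A by apply/setIidPl => x /AEG[].
      have EAG : ((E `&` G) `\` A) `&` G = (E `&` G) `\` A.
        by apply/setIidPl => x [[]].
      rewrite AG EAG GB -setIA setIid => ->; split => //.
      have := nule set0 measurable0 (@sub0set _ E).
      by rewrite measure0/= normr_le0 => /eqP ->; rewrite subr0.
    + by split; [apply: hA|apply: hB]; apply/predU1P; right.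
  have -> : E `&` F = (E `&` G `&` F) `|` ((E `\` G) `&` F).
    by rewrite -setIUl setUIDK.
  have -> : (A `|` B) `&` F = (A `&` F) `|` (B `&` F) by rewrite setIUl.
  have -> : (E `\` (A `|` B)) `&` F =
      (((E `&` G) `\` A) `&` F) `|` (((E `\` G) `\` B) `&` F).
    rewrite -setIUl; congr (_ `&` _); apply/seteqP; split => x.
      move=> [Ex /not_orP[nA nB]]; have [Gx|Gx] := pselect (G x); by [left|right].
    by move=> [[[Ex Gx] nA]|[[Ex Gx] nB]]; split => // -[|] //;
      [move=> /BEG[]|move=> /AEG[]].
  have disj P Q : P `<=` G -> Q `<=` ~` G -> P `&` Q = set0.
    by move=> PG QG; apply/seteqP; split => // x [/PG ? /QG].
  have AE : A `<=` E by move=> x /AEG[].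
  have BE : B `<=` E by move=> x /BEG[].
  have mI P : measurable P -> measurable (P `&` F) by move=> mP; exact: measurableI.
  have subF P Q : P `<=` Q -> P `&` F `<=` Q by move=> PQ x [/PQ].
  rewrite nuD.
  - rewrite (fine_measureU hE (mI _ mA) (mI _ mB)).
    + rewrite (fine_measureU hE (mI _ (measurableD mEG mA)) (mI _ (measurableD mEDG mB))).
      * by rewrite -eqA -eqB; ring.
      * by apply: subF => x [[]].
      * by apply: subF => x [[]].
      * by apply: disj; apply: subF => x [[]].
    + exact: subF.
    + exact: subF.
    + by apply: disj; apply: subF => x; [move=> /AEG[]|move=> /BEG[]].
  - exact: mI.
  - exact: mI.
  - by apply: subF => x [].
  - by apply: subF => x [].
  - by apply: disj; apply: subF => x [].
Qed.

End Sierpinski.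

(** * Preduals of L_1 *)

Section L1Representation.
Context d (T : measurableType d) (R : realType).
Variable mu : {measure set T -> \bar R}.
Local Notation L1 := (Lfun mu 1).

Definition L1norm (f : T -> R) : R := \int[mu]_x `|f x|.

(** Linearity on integrable functions only: the functionals considered below are
    defined on all functions, with meaningless values elsewhere. *)
Definition L1_linear (Theta : (T -> R) -> R) := forall (a : R) (f g : T -> R),
  f \in L1 -> g \in L1 -> Theta (a *: f + g) = a * Theta f + Theta g.

Lemma Lfun1_measurable (f : T -> R) : f \in L1 -> measurable_fun setT f.
Proof. by move=> fL; have := sub_Lfun_mfun fL; rewrite inE. Qed.

Lemma EFin_L1norm (f : T -> R) : f \in L1 ->
  (L1norm f)%:E = 'N[mu]_1[EFin \o f]%E.
Proof.
move=> fL; rewrite Lnorm1 /L1norm /Rintegral fineK//.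
have /Lfun1_integrable fi : Num.norm \o f \in L1 by exact: Lfun_norm.
exact: integrable_fin_num fi.
Qed.

Lemma ae_eq_Lnorm1 (f g : T -> R) : measurable_fun setT f ->
  measurable_fun setT g -> ae_eq mu setT f g ->
  'N[mu]_1[EFin \o f]%E = 'N[mu]_1[EFin \o g]%E.
Proof.
move=> mf mg fg; rewrite !Lnorm1; apply: ae_eq_integral => //.
- by apply: measurableT_comp => //; exact/measurable_EFinP.
- by apply: measurableT_comp => //; exact/measurable_EFinP.
- by apply: filterS fg => x h /h /= ->.
Qed.

Lemma Lspace_of_Lfun (f : T -> R) : f \in L1 ->
  exists h : LspaceType1 mu, ae_eq mu setT (h : T -> R) f.
Proof.
move=> fL; have mf := Lfun1_measurable fL.
pose m : {mfun T >-> measurableTypeR R} := 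
  @mfun_Sub _ _ T (measurableTypeR R) f (mem_set mf).
pose q : {mfun_ mu, T >-> measurableTypeR R} := (\pi m)%qT.
have qm : ae_eq mu setT (q : T -> R) f.
  have : (repr q = m %[mod {mfun_ mu, T >-> measurableTypeR R}])%qT by rewrite reprK.
  by move=> /eqP; rewrite eqmodE => /asboolP; apply: filterS => x h _; exact: h.
have fq : finite_norm mu 1 (q : T -> R).
  rewrite /finite_norm (ae_eq_Lnorm1 _ mf qm); last exact: measurable_funPT (repr q).
  by have := sub_Lfun_finLfun fL; rewrite inE.
by exists (LebesgueSpace.Pack (LebesgueSpace.Class
  (@isFinLebesgue.Axioms_ _ T R mu _ (lexx 1%E) q fq))).
Qed.

Lemma Lspace_Lfun (h : LspaceType1 mu) : (h : T -> R) \in L1.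
Proof.
by rewrite inE; apply/andP; split; rewrite inE/=; [exact: measurable_funPT (repr (h : {mfun_ mu, T >-> measurableTypeR R}))|exact: Lebesgue_finite].
Qed.

(** The isometry is transported from classes to integrable functions, so that
    the rest of the proof can compute with functions: L f x is the pairing of f
    with x. *)
Lemma L1_representation (X : completeNormedModType R) : is_predual_of_L1 mu X ->
  exists L : (T -> R) -> X -> R,
    [/\ forall f, f \in L1 -> dual (L f),
        forall f, f \in L1 -> dual_norm (L f) = L1norm f,
        forall x, L1_linear (L ^~ x)
      & forall phi, dual phi -> exists2 f, f \in L1 & phi = L f].
Proof.
move=> [J [Jlin Jnorm Jrange]].
have [h0 _] : exists h : LspaceType1 mu, ae_eq mu setT (h : T -> R) (cst 0).
  by apply: Lspace_of_Lfun; exact: rpred0.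
have : forall f : T -> R, exists h : LspaceType1 mu, f \in L1 -> ae_eq mu setT (h : T -> R) f.
  move=> f; have [fL|nfL] := boolP (f \in L1); last by exists h0.
  by have [h hf] := Lspace_of_Lfun fL; exists h.
move=> /choice[c hc].
exists (fun f => J (c f)); split.
- by move=> f _; rewrite -Jrange; exists (c f).
- move=> f fL; apply: EFin_inj; rewrite Jnorm EFin_L1norm//.
  by apply: ae_eq_Lnorm1 (hc _ fL); [exact/Lfun1_measurable/Lspace_Lfun|exact: Lfun1_measurable].
- move=> x a f g fL gL; rewrite (Jlin a (c f) (c g))//.
  have aL : a *: f + g \in L1 by rewrite rpredD ?rpredZ.
  move: (hc _ fL) (hc _ gL) (hc _ aL); apply: filterS3 => t cf cg ca _.
  by rewrite ca// cf// cg.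
- move=> phi; rewrite -Jrange => -[h _ <-]; exists (h : T -> R).
    exact: Lspace_Lfun.
  rewrite (Jlin 0 h h (c h)).
    by apply/funext => x; rewrite mul0r add0r.
  have := hc _ (Lspace_Lfun h); apply: filterS => t ch _.
  by rewrite ch// mul0r add0r.
Qed.

End L1Representation.

(** * Approximation by simple functions on a set of finite measure *)

Section SimpleApproximation.
Import HBSimple.
Context d (T : measurableType d) (R : realType).
Variable mu : {measure set T -> \bar R}.
Local Notation L1 := (Lfun mu 1).
Local Notation m A := (fine (mu A)).
Implicit Types (A B E F : set T) (f g h : T -> R).

Lemma Lfun1_integrableS A f : measurable A -> f \in L1 ->
  mu.-integrable A (EFin \o f).
Proof. by move=> mA /Lfun1_integrable; apply: integrableS. Qed.

Lemma Lfun1_restrict A f : measurable A -> f \in L1 -> f \_ A \in L1.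
Proof.
move=> mA fL; apply/Lfun1_integrable; rewrite -restrict_EFin.
by apply/(integrable_mkcond _ mA); exact: Lfun1_integrableS.
Qed.

Lemma Lfun1_indic A : measurable A -> (mu A < +oo)%E -> (\1_A : T -> R) \in L1.
Proof.
move=> mA Aoo; apply/Lfun1_integrable; apply/integrableP; split.
  exact/measurable_EFinP/measurable_indic.
under eq_integral do rewrite /= ger0_norm//.
by rewrite integral_indic// setIT.
Qed.

Lemma Rintegral_indic A B : measurable A -> measurable B ->
  \int[mu]_(x in A) (\1_B x : R) = m (B `&` A).
Proof. by move=> mA mB; rewrite /Rintegral integral_indic. Qed.

Lemma indic_disjU A B : A `&` B = set0 -> (\1_(A `|` B) : T -> R) = \1_A + \1_B.
Proof.
move=> AB0; apply/funext => x.
rewrite -[RHS]/((\1_A : T -> R) x + \1_B x) !indicE in_setU.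
have : (x \in A) && (x \in B) = false by rewrite -in_setI AB0 in_set0.
by case: (x \in A); case: (x \in B) => //=; rewrite ?addr0 ?add0r.
Qed.

Lemma L1norm_indic A : measurable A -> L1norm mu (\1_A : T -> R) = m A.
Proof.
move=> mA; rewrite /L1norm; under eq_Rintegral do rewrite ger0_norm//.
by rewrite Rintegral_indic// setIT.
Qed.

Lemma L1normZ (a : R) f : f \in L1 -> L1norm mu (a *: f) = `|a| * L1norm mu f.
Proof.
move=> fL; rewrite /L1norm -RintegralZl//; last first.
  by apply: Lfun1_integrableS => //; exact: Lfun_norm.
by apply: eq_Rintegral => x _; exact: normrM.
Qed.

Lemma L1norm_restrict A f : L1norm mu (f \_ A) = \int[mu]_(x in A) `|f x|.
Proof.
rewrite Rintegral_mkcond /L1norm; apply: eq_Rintegral => x _.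
by rewrite /patch; case: ifP; rewrite ?normr0.
Qed.

Lemma L1norm_split A E f : measurable A -> measurable E -> A `<=` E -> f \in L1 ->
  L1norm mu f = \int[mu]_(x in A) `|f x| + \int[mu]_(x in E `\` A) `|f x|
    + L1norm mu (f \_ ~` E).
Proof.
move=> mA mE AE fL.
have mEA : measurable (E `\` A) by exact: measurableD.
have mCE : measurable (~` E) by exact: measurableC.
have absi B : measurable B -> mu.-integrable B (EFin \o (fun x => `|f x|)).
  by move=> mB; apply: Lfun1_integrableS => //; exact: Lfun_norm.
rewrite L1norm_restrict -Rintegral_setU ?setDUK//; last 2 first.
  exact: absi.
  by rewrite disj_set2E setDIK.
rewrite -Rintegral_setU// ?setUv//; first exact: absi.
by rewrite disj_set2E setICr.
Qed.

Lemma Rintegral_L1_linear A : measurable A ->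
  L1_linear mu (fun f => \int[mu]_(x in A) f x).
Proof.
move=> mA a f g fL gL; rewrite -RintegralZl//; last exact: Lfun1_integrableS.
rewrite -RintegralD//; last exact: Lfun1_integrableS.
exact: (Lfun1_integrableS mA (rpredZ _ fL)).
Qed.

Section Linear.
Variable Theta : (T -> R) -> R.
Hypothesis Theta_lin : L1_linear mu Theta.

Lemma L1_linear0 : Theta 0 = 0.
Proof.
have := @Theta_lin 1 0 0 (rpred0 _) (rpred0 _).
by rewrite scale1r addr0 mul1r => /(_ (lexx _) (lexx _)) h; lra.
Qed.

Lemma L1_linearD f g : f \in L1 -> g \in L1 -> Theta (f + g) = Theta f + Theta g.
Proof. by move=> fL gL; rewrite -[f in LHS]scale1r Theta_lin// mul1r. Qed.

Lemma L1_linearZ a f : f \in L1 -> Theta (a *: f) = a * Theta f.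
Proof.
by move=> fL; rewrite -[a *: f]addr0 Theta_lin ?rpred0// L1_linear0 addr0.
Qed.

Lemma L1_linearB f g : f \in L1 -> g \in L1 -> Theta (f - g) = Theta f - Theta g.
Proof.
by move=> fL gL; rewrite addrC -scaleN1r Theta_lin// mulN1r addrC.
Qed.

Lemma L1_linear_sum (I : Type) (r : seq I) (a : I -> R) (f : I -> T -> R) :
  (forall i, f i \in L1) ->
  Theta (\sum_(i <- r) a i *: f i) = \sum_(i <- r) a i * Theta (f i).
Proof.
move=> fL; elim: r => [|i r IH]; first by rewrite !big_nil L1_linear0.
rewrite !big_cons Theta_lin ?IH//.
by apply: rpred_sum => j _; exact: rpredZ.
Qed.

End Linear.

Lemma simple_approx E g (e : R) : measurable E -> (mu E < +oo)%E -> g \in L1 ->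
  0 < e -> exists (r : seq R) (F : R -> set T), (forall y, measurable (F y)) /\
    L1norm mu (g \_ E - \sum_(y <- r) y *: (\1_(E `&` F y) : T -> R)) < e.
Proof.
move=> mE Eoo gL e0.
have [s [si _ cvs]] := approximation_sfun_integrable mE (Lfun1_integrableS mE gL).
have [n hn] : exists n, (\int[mu]_(z in E) `|(EFin \o g) z - (s n z)%:E| < e%:E)%E.
  have /fine_cvgP[finI /cvgrPdist_lt /(_ _ e0) small] := cvs.
  have [n [fn sn]] := filter_ex (filterI finI small).
  by exists n; move: sn; rewrite sub0r normrN -lte_fin -(fineK fn) ger0_norm// fine_ge0// integral_ge0.
exists (finmap.enum_fset (fset_set (range (s n)))), (fun y => s n @^-1` [set y]); split => //.
have -> : g \_ E - \sum_(y <- finmap.enum_fset (fset_set (range (s n)))) y *: (\1_(E `&` (s n @^-1` [set y])) : T -> R)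
    = (g - s n) \_ E.
  apply/funext => x; rewrite -[LHS]/((g \_ E) x - (\sum_(y <- _) _) x) fct_sumE.
  have sum_indic : \sum_(y <- finmap.enum_fset (fset_set (range (s n))))
      (y *: (\1_(E `&` (s n @^-1` [set y])) : T -> R)) x = (\1_E x : R) * s n x.
    rewrite [in RHS](fimfunE (s n)) fsbig_finite//= mulr_sumr; apply: eq_bigr => y _.
    by rewrite indicI /= mulrCA.
  rewrite sum_indic /patch indicE; case: ifP => _; first by rewrite mul1r.
  by rewrite mul0r subr0.
rewrite L1norm_restrict -lte_fin /Rintegral fineK//.
by rewrite ge0_fin_numE ?integral_ge0//; exact: lt_trans hn (ltry _).
Qed.

(** A bounded functional that vanishes on the level sets of a simple function
    close to g is small at g. The level sets are found before the functional,
    which is what allows one sign function to serve several g at once. *)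
Lemma L1_linear_small E g (e : R) : measurable E -> (mu E < +oo)%E -> g \in L1 ->
  0 < e -> exists Fs : seq (set T), (forall F, F \in Fs -> measurable F) /\
    forall Theta, L1_linear mu Theta ->
      (forall h, h \in L1 -> `|Theta h| <= 2 * L1norm mu h) ->
      (forall F, F \in Fs -> Theta \1_(E `&` F) = 0) ->
      `|Theta (g \_ E)| < e.
Proof.
move=> mE Eoo gL e0.
have [|r [F [mF hr]]] := simple_approx (e := e / 2) mE Eoo gL; first by rewrite divr_gt0.
exists [seq F y | y <- r]; split => [_ /mapP[y _ ->]//|Theta lin bnd Theta0].
have FL y : (\1_(E `&` F y) : T -> R) \in L1.
  apply: Lfun1_indic; first exact: measurableI.
  by apply: le_lt_trans Eoo; apply: le_measure; rewrite ?inE//; exact: measurableI.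
have sL : \sum_(y <- r) y *: (\1_(E `&` F y) : T -> R) \in L1.
  by apply: rpred_sum => y _; exact: rpredZ.
have gEL := Lfun1_restrict mE gL.
rewrite -[g \_ E](subrK (\sum_(y <- r) y *: (\1_(E `&` F y) : T -> R))).
rewrite (L1_linearD lin)//; last by rewrite rpredB.
have s0 : \sum_(y <- r) y * Theta \1_(E `&` F y) = 0.
  rewrite big_seq big1 => // y yr.
  by rewrite Theta0 ?mulr0//; exact: map_f.
rewrite (L1_linear_sum lin)// s0 addr0 (le_lt_trans (bnd _ _))// ?rpredB//.
by move: hr; lra.
Qed.

(** [split_measure] is applied to nu = Lambda on indicators; the difference
    Theta between integration against the sign function and Lambda then vanishes
    on finitely many chosen indicators, and its norm is at most 2. *)
Lemma sign_matching E (gs : seq (T -> R)) (Lambda : (T -> R) -> R) (e : R) :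
  finite_atomless mu E -> (forall g, g \in gs -> g \in L1) ->
  L1_linear mu Lambda -> (forall h, h \in L1 -> `|Lambda h| <= L1norm mu h) ->
  0 < e ->
  exists A, [/\ measurable A, A `<=` E & forall g, g \in gs ->
    `|\int[mu]_(x in A) g x - \int[mu]_(x in E `\` A) g x - Lambda (g \_ E)| < e].
Proof.
move=> hE gsL lin bnd e0; have [mE Eoo _] := hE.
have [Fs [mFs hFs]] : exists Fs : seq (set T), (forall F, F \in Fs -> measurable F) /\
    forall Theta, L1_linear mu Theta ->
      (forall h, h \in L1 -> `|Theta h| <= 2 * L1norm mu h) ->
      (forall F, F \in Fs -> Theta \1_(E `&` F) = 0) ->
      forall g, g \in gs -> `|Theta (g \_ E)| < e.
  elim: gs gsL => [|g gs IH] gsL; first by exists [::].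
  have [|Fs [mFs hFs]] := IH.
    by move=> h hgs; apply: gsL; rewrite inE hgs orbT.
  have gL : g \in L1 by apply: gsL; rewrite inE eqxx.
  have [Gs [mGs hGs]] := L1_linear_small mE Eoo gL e0.
  exists (Fs ++ Gs); split => [F|Theta tlin tbnd t0 h].
    by rewrite mem_cat => /orP[/mFs|/mGs].
  rewrite inE => /predU1P[->|hgs].
    by apply: hGs => // F FG; apply: t0; rewrite mem_cat FG orbT.
  by apply: hFs => // F FF; apply: t0; rewrite mem_cat FF.
have indL A : measurable A -> A `<=` E -> (\1_A : T -> R) \in L1.
  move=> mA AE; apply: Lfun1_indic => //.
  by apply: le_lt_trans Eoo; apply: le_measure; rewrite ?inE.
have [A [mA AE hA]] : exists A, [/\ measurable A, A `<=` E & forall F, F \in setT :: Fs ->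
        m (A `&` F) - m ((E `\` A) `&` F) = Lambda \1_(E `&` F)].
  apply: (split_measure (nu := fun F => Lambda \1_F)) => //.
  - by move=> F mF FE; rewrite (le_trans (bnd _ _)) ?L1norm_indic// indL.
  - move=> F G mF mG FE GE FG0.
    by rewrite indic_disjU// (L1_linearD lin)// indL.
exists A; split => // g ggs.
have mEA : measurable (E `\` A) by exact: measurableD.
pose Theta h := \int[mu]_(x in A) h x - \int[mu]_(x in E `\` A) h x - Lambda h.
have restr B f : B `<=` E -> \int[mu]_(x in B) (f \_ E) x = \int[mu]_(x in B) f x.
  by move=> BE; apply: eq_Rintegral => x; rewrite inE => /BE Ex; rewrite /patch mem_set.
rewrite -(restr A)// -(restr (E `\` A)); last by move=> x [].
apply: (hFs Theta) => //.
- move=> a f h fL hL; rewrite /Theta lin//.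
  by rewrite !Rintegral_L1_linear//; ring.
- move=> h hL; rewrite /Theta (le_trans (ler_normB _ _))// mulr2n mulrDl !mul1r.
  rewrite lerD ?bnd//.
  have hi B : measurable B -> mu.-integrable B (EFin \o h) by move=> mB; exact: Lfun1_integrableS.
  rewrite (le_trans (ler_normB _ _))//.
  rewrite (le_trans (lerD (le_normr_Rintegral mA (hi _ mA)) (le_normr_Rintegral mEA (hi _ mEA))))//.
  by rewrite (L1norm_split mA mE AE hL) lerDl L1norm_restrict Rintegral_ge0.
- move=> F FF; have mF := mFs _ FF.
  rewrite /Theta !Rintegral_indic//; try exact: measurableI.
  have /hA <- : F \in setT :: Fs by rewrite inE FF orbT.
  have -> : (E `&` F) `&` A = A `&` F by rewrite setIAC (setIidr AE).
  have -> : (E `&` F) `&` (E `\` A) = (E `\` A) `&` F.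
    by rewrite setIAC setIDA setIid.
  by rewrite subrr.
Qed.

End SimpleApproximation.

(** * The contradiction *)

Section Assembly.
Context d (T : measurableType d) (R : realType).
Variable mu : {measure set T -> \bar R}.
Variable X : completeNormedModType R.
Local Notation L1 := (Lfun mu 1).
Local Notation m A := (fine (mu A)).

Lemma not_purely_atomic : semifinite mu -> ~ purely_atomic mu ->
  exists2 E, finite_atomless mu E & 0 < m E.
Proof.
move=> semi nat.
have [E [mE E0 noat]] : exists E, [/\ measurable E, (0 < mu E)%E &
    forall A, A `<=` E -> ~ atom mu A].
  apply: contrapT => noE; apply: nat => E mE E0; apply: contrapT => noat.
  by apply: noE; exists E; split => // A AE atA; apply: noat; exists A.
have [F [mF FE F0 Foo]] : exists F, [/\ measurable F, F `<=` E, (0 < mu F)%E & (mu F < +oo)%E].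
  have [Eoo|] := eqVneq (mu E) +oo%E; first exact: semi.
  by rewrite -ltey => Efin; exists E; split.
exists F; last by rewrite fine_gt0// F0.
by split => // A AF; apply: noat; exact: subset_trans FE.
Qed.

(** Here p y <= |p| and - q z <= |q|, which the slice conditions turn into
    p y - q y < 2 |p| - 1/2 and p z - q z < 2 |q| - 1/2. When p and q come from
    the normalised indicators of the parts of E where a sign function is 1 and
    -1, this says that midpoints of the two opposite slices are small on E. *)
Lemma slice_midpoint (p q : X -> R) (y z : X) : dual p -> dual q ->
  dual_norm p + dual_norm q <= 1 ->
  slice (fun x => p x + q x) 2^-1 y ->
  slice (fun x => - (p x + q x)) 2^-1 z ->
  p (2^-1 *: (y + z)) - q (2^-1 *: (y + z)) < 2^-1.
Proof.
move=> dp dq pq1 [y1 hy] [z1 hz]; rewrite (dualZ dp) (dualZ dq) (dualD dp) (dualD dq).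
have /ler_normlP[_ py] := le_dual_norm dp y1.
have /ler_normlP[qz _] := le_dual_norm dq z1.
by lra.
Qed.

Section Representation.
Variable L : (T -> R) -> X -> R.
Hypothesis L_dual : forall f, f \in L1 -> dual (L f).
Hypothesis L_norm : forall f, f \in L1 -> dual_norm (L f) = L1norm mu f.
Hypothesis L_lin : forall x, L1_linear mu (L ^~ x).

Lemma L1_goldstine (psi : (T -> R) -> R) (I : finType) (h : I -> T -> R) (e : R) :
  L1_linear mu psi -> (forall f, f \in L1 -> `|psi f| <= L1norm mu f) ->
  (forall i, h i \in L1) -> 0 < e ->
  exists2 x, unit_ball x & forall i, `|L (h i) x - psi (h i)| < e.
Proof.
move=> psi_lin psi_bnd hL e0.
apply: helly => // [i|a]; first exact: L_dual.
have aL : \sum_i a i *: h i \in L1 by apply: rpred_sum => i _; exact: rpredZ.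
rewrite -(L1_linear_sum psi_lin)//.
have -> : (fun x => \sum_i a i * L (h i) x) = L (\sum_i a i *: h i).
  by apply/funext => x; rewrite (L1_linear_sum (L_lin x)).
by rewrite L_norm// (le_trans (ler_norm _))// psi_bnd.
Qed.

(** The functional psi is the sign function of the splitting on E and x0 off E.
    It takes the value 1 at the normalised sign function itself. *)
Lemma ball_sign_approx E (gs : seq (T -> R)) (x0 : X) (e : R) :
  finite_atomless mu E -> 0 < m E -> (forall g, g \in gs -> g \in L1) ->
  unit_ball x0 -> 0 < e ->
  exists A x, [/\ measurable A, A `<=` E, unit_ball x,
    forall g, g \in gs -> `|L g x - L g x0| < e
    & 1 - e < L ((m E)^-1 *: ((\1_A : T -> R) - \1_(E `\` A))) x].
Proof.
move=> hE E0 gsL x01 e0; have [mE Eoo _] := hE.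
have Lx0_bnd h : h \in L1 -> `|L h x0| <= L1norm mu h.
  by move=> hL; rewrite -L_norm// le_dual_norm//; exact: L_dual.
have e20 : 0 < e / 2 by rewrite divr_gt0.
have [A [mA AE hA]] := sign_matching hE gsL (L_lin x0) Lx0_bnd e20.
have mEA : measurable (E `\` A) by exact: measurableD.
have mCE : measurable (~` E) by exact: measurableC.
pose psi h := \int[mu]_(x in A) h x - \int[mu]_(x in E `\` A) h x + L (h \_ ~` E) x0.
have psi_lin : L1_linear mu psi.
  move=> a f g fL gL; rewrite /psi !Rintegral_L1_linear//.
  have -> : (a *: f + g) \_ (~` E) = (a *: (f \_ (~` E)) : T -> R) + (g \_ (~` E)).
    apply/funext => x.
    rewrite -[RHS]/(a * (f \_ ~` E) x + (g \_ ~` E) x) /patch.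
    by case: ifP => // _; rewrite mulr0 addr0.
  by rewrite L_lin ?Lfun1_restrict//; ring.
have psi_bnd h : h \in L1 -> `|psi h| <= L1norm mu h.
  move=> hL; rewrite (L1norm_split mA mE AE hL).
  rewrite (le_trans (ler_normD _ _))// lerD// ?Lx0_bnd ?Lfun1_restrict//.
  rewrite (le_trans (ler_normB _ _))// lerD// le_normr_Rintegral//;
    exact: Lfun1_integrableS.
have indL B : measurable B -> B `<=` E -> (\1_B : T -> R) \in L1.
  move=> mB BE; apply: Lfun1_indic => //.
  by apply: le_lt_trans Eoo; apply: le_measure; rewrite ?inE.
have EAE : E `\` A `<=` E by move=> x [].
pose u : T -> R := (m E)^-1 *: ((\1_A : T -> R) - \1_(E `\` A)).
have uL : u \in L1 by rewrite rpredZ// rpredB// indL.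
(* The index None carries the sign function, added to the given family. *)
pose h (i : option 'I_(size gs)) := if i is Some j then nth u gs j else u.
have hL i : h i \in L1 by case: i => [j|]//=; apply: gsL; exact: mem_nth.
have [x x1 hx] := L1_goldstine psi_lin psi_bnd hL e20.
exists A, x; split => //.
  move=> g ggs; have gL := gsL _ ggs.
  have ig : (index g gs < size gs)%N by rewrite index_mem.
  have := hx (Some (Ordinal ig)); rewrite /= nth_index// => Lpsi.
  have gE : L g x0 = L (g \_ E) x0 + L (g \_ ~` E) x0.
    rewrite -(L1_linearD (L_lin x0)) ?Lfun1_restrict//; congr (L _ x0).
    apply/funext => t; rewrite -[RHS]/((g \_ E) t + (g \_ ~` E) t) /patch in_setC.
    by case: (t \in E); rewrite /= ?addr0 ?add0r.
  have -> : L g x - L g x0 = (L g x - psi g) +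
     (\int[mu]_(x in A) g x - \int[mu]_(x in E `\` A) g x - L (g \_ E) x0).
    by rewrite gE /psi; ring.
  rewrite (le_lt_trans (ler_normD _ _))// [e]splitr ltrD//.
  exact: hA.
have psiu : psi u = 1.
  have lin_int B : measurable B -> B `<=` E -> \int[mu]_(x in B) u x =
      (m E)^-1 * (m (A `&` B) - m ((E `\` A) `&` B)).
    move=> mB BE.
    pose intB f := \int[mu]_(x in B) f x.
    have int_lin : L1_linear mu intB by exact: Rintegral_L1_linear.
    rewrite -[LHS]/(intB u) (L1_linearZ int_lin) ?rpredB ?indL//.
    by rewrite (L1_linearB int_lin) ?indL// /intB !Rintegral_indic.
  rewrite /psi !lin_int// !setIid (setIC (E `\` A) A) setDIK measure0/=.
  have -> : u \_ (~` E) = 0.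
    apply/funext => t; rewrite /patch in_setC; case: ifPn => // nE.
    rewrite /u -[LHS]/((m E)^-1 * ((\1_A : T -> R) t - \1_(E `\` A) t)) !indicE.
    have /negbTE -> : t \notin A by apply: contra nE => /set_mem/AE/mem_set.
    have /negbTE -> : t \notin E `\` A by apply: contra nE => /set_mem/EAE/mem_set.
    by rewrite subrr mulr0.
  rewrite (L1_linear0 (L_lin x0)) addr0.
  rewrite subr0 sub0r mulrN opprK -mulrDr -(fine_measureD hE)//.
  by rewrite mulVf// gt_eqF.
have := hx None; rewrite /= psiu ltr_norml => /andP[lo _].
by move: lo; rewrite -/u; lra.
Qed.

End Representation.

End Assembly.

Theorem theorem4p7 (R : realType) (d : measure_display) (T : measurableType d)
    (mu : {measure set T -> \bar R}) (X : completeNormedModType R)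
    (mu_localizable : localizable mu) (X_predual : is_predual_of_L1 mu X)
    (X_W2 : W2 X) :
  purely_atomic mu.
Proof.
apply: contrapT => /(not_purely_atomic mu_localizable.1)[E hE E0].
have [L [L_dual L_norm L_lin L_onto]] := L1_representation X_predual.
have [mE Eoo _] := hE.
have indL B : measurable B -> B `<=` E -> (\1_B : T -> R) \in Lfun mu 1.
  move=> mB BE; apply: Lfun1_indic => //.
  by apply: le_lt_trans Eoo; apply: le_measure; rewrite ?inE.
pose c := (fine (mu E))^-1.
have c0 : 0 < c by rewrite invr_gt0.
have cL B : measurable B -> B `<=` E -> c *: (\1_B : T -> R) \in Lfun mu 1.
  by move=> mB BE; rewrite rpredZ// indL.
have cnorm B : measurable B -> B `<=` E ->
    dual_norm (L (c *: (\1_B : T -> R))) = c * fine (mu B).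
  move=> mB BE; rewrite L_norm ?cL//.
  by rewrite L1normZ ?indL// L1norm_indic// gtr0_norm.
have f1 : dual_norm (L (c *: (\1_E : T -> R))) = 1.
  by rewrite cnorm// mulVf// gt_eqF.
have half0 : 0 < 2^-1 :> R by rewrite invr_gt0.
have [x0 [x01 [s [e [e0 ds hs]]]]] := W2_symmetric_slices X_W2 (L_dual _ (cL E mE (@subset_refl _ E))) f1 half0.
have /choice[rep hrep] : forall phi : X -> R, exists g : T -> R,
    dual phi -> g \in Lfun mu 1 /\ phi = L g.
  move=> phi; have [/L_onto[g gL ->]|nd] := pselect (dual phi); last by exists 0.
  by exists g.
have gsL g : g \in [seq rep phi | phi <- s] -> g \in Lfun mu 1.
  by move=> /mapP[phi /ds/hrep[? _] ->].
have [|A [x [mA AE x1 gx ux]]] := ball_sign_approx L_dual L_norm L_lin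
  (e := Num.min e 2^-1) hE E0 gsL x01; first by rewrite lt_min e0.
have [|y [z [hy hz xyz]]] := hs _ x1.
  move=> phi phis; have [_ ->] := hrep _ (ds _ phis).
  have := gx (rep phi) (map_f _ phis).
  by rewrite lt_min => /andP[].
have mEA : measurable (E `\` A) by exact: measurableD.
have EAE : E `\` A `<=` E by move=> t [].
pose p := L (c *: (\1_A : T -> R)); pose q := L (c *: (\1_(E `\` A) : T -> R)).
have pqE : L (c *: (\1_E : T -> R)) = (fun x => p x + q x).
  apply/funext => t; rewrite /p /q -(L1_linearD (L_lin t)) ?cL// -scalerDr.
  by rewrite -indic_disjU ?setDIK// setDUK.
have dp : dual p by apply: L_dual; exact: cL.
have dq : dual q by apply: L_dual; exact: cL.
have pq1 : dual_norm p + dual_norm q <= 1.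
  by rewrite !cnorm// -mulrDr -(fine_measureD hE)// mulVf// gt_eqF.
rewrite pqE in hy hz.
have := slice_midpoint dp dq pq1 hy hz; rewrite -xyz.
have : 1 - 2^-1 < p x - q x.
  have -> : p x - q x = L (c *: ((\1_A : T -> R) - \1_(E `\` A))) x.
    rewrite (L1_linearZ (L_lin x)) ?rpredB ?indL// (L1_linearB (L_lin x)) ?indL//.
    by rewrite /p /q !(L1_linearZ (L_lin x)) ?indL// mulrBr.
  by apply: le_lt_trans ux; rewrite lerB// ge_min lexx orbT.
by lra.
Qed.
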